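(* Let $X$ be a uniformly smooth (real) Banach space with modulus of smoothness $\rho(u)\le\gamma u^q$ for some $\gamma>0$ and $1<q\le2$, let $p=q/(q-1)$, and let $\mathcal D$ be a dictionary in $X$. Let the sequences $\{t_m\}_{m=1}^\infty$, $\{\delta_m\}_{m=0}^\infty$, $\{\eta_m\}_{m=1}^\infty$ of numbers from $[0,1]$ and $\{\epsilon_m\}_{m=1}^\infty$ of non-negative numbers be such that $$\sum_{k=1}^\infty t_k^p=\infty,\qquad \delta_{m-1}+\eta_m=o(t_m^p),\qquad \epsilon_m=o(1)\qquad (m\to\infty).$$ Then any algorithm from the class $\mathcal{AWBGA}$ with weakness sequence $\{t_m\}$ and error parameters $\{\delta_m\},\{\eta_m\},\{\epsilon_m\}$ converges for any target element $f\in X$, i.e. its remainders satisfy $\lim_{m\to\infty}\|f_m\|=0$.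
   Context: A dictionary in a real Banach space $X$ is a set $\mathcal D\subset X$ such that $\|g\|\le 1$ for all $g\in\mathcal D$, the closed linear span of $\mathcal D$ is $X$, and $g\in\mathcal D$ implies $-g\in\mathcal D$. For $F\in X'$, $\|F\|_{\mathcal D}:=\sup_{g\in\mathcal D}F(g)$. The modulus of smoothness is $\rho(u)=\sup_{\|x\|=\|y\|=1}\frac{\|x+uy\|+\|x-uy\|}{2}-1$; $X$ is uniformly smooth if $\lim_{u\to0}\rho(u)/u=0$. The bound $\rho(u)\le\gamma u^q$ is for all $u\ge0$. The relation $a_m=o(t_m^p)$ means that for every $c>0$ one has $a_m\le c\,t_m^p$ for all sufficiently large $m$. An algorithm from the class $\mathcal{AWBGA}$ (Approximate Weak Biorthogonal Greedy Algorithms) with weakness sequence $\{t_m\}_{m\ge1}\subset[0,1]$ and error parameters $\{\delta_m\}_{m\ge0},\{\eta_m\}_{m\ge1}\subset[0,1]$, $\{\epsilon_m\}_{m\ge1}\subset[0,\infty)$, applied to a target $f\in X$, produces elements $\varphi_m\in\mathcal D$ ($m\ge1$), approximants $G_m\in\operatorname{span}\{\varphi_1,\dots,\varphi_m\}$ with $G_0=0$, and remainders $f_m=f-G_m$ ($f_0=f$), for which there are functionals $F_m\in X'$ ($m\ge0$) with $\|F_m\|\le1$ and $F_m(f_m)\ge(1-\delta_m)\|f_m\|$, such that for every $m\ge1$: (1) $F_{m-1}(\varphi_m)\ge t_m\|F_{m-1}\|_{\mathcal D}$; (2) $\|f_m\|\le(1+\eta_m)\inf_{\lambda\ge0}\|f_{m-1}-\lambda\varphi_m\|$;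 (3) $|F_m(G_m)|\le\epsilon_m$. Requirements involving $F_k$ are imposed only when $f_k\ne0$. *)

(* Defs.v *)
From HB Require Import structures.
From mathcomp Require Import all_boot all_order all_algebra.
From mathcomp Require Import all_classical all_reals all_analysis.

Set Implicit Arguments.
Unset Strict Implicit.
Unset Printing Implicit Defensive.

Import Order.TTheory GRing.Theory Num.Theory.
Import numFieldNormedType.Exports.

Local Open Scope classical_set_scope.
Local Open Scope ring_scope.

Definition linear_span (R : realType) (X : lmodType R) (A : set X) : set X :=
  [set x | exists (n : nat) (a : 'I_n -> R) (g : 'I_n -> X),
     (forall i, A (g i)) /\ x = \sum_(i < n) a i *: g i].

Definition dictionary (R : realType) (X : normedModType R) (D : set X) : Prop :=
  [/\ forall g, D g -> `|g| <= 1,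
      closure (linear_span D) = setT &
      forall g, D g -> D (- g)].

(* In the norms and the modulus below, [sup] and [inf] are those of [R], with
   [sup set0 = 0]. Each set is bounded for continuous functionals and
   dictionaries; the set defining [modulus_of_smoothness] is empty only if
   [X] is the zero space, and the one defining [dict_norm] only if [D] is. *)
Definition dual_norm (R : realType) (X : normedModType R)
    (F : {linear X -> R^o}) : R :=
  sup [set `|F x| | x in [set x : X | `|x| <= 1]].

Definition dict_norm (R : realType) (X : normedModType R) (D : set X)
    (F : {linear X -> R^o}) : R :=
  sup [set F g | g in D].

Definition modulus_of_smoothness (R : realType) (X : normedModType R)
    (u : R) : R :=
  sup [set r | exists x y : X, [/\ `|x| = 1, `|y| = 1 &
         r = (`|x + u *: y| + `|x - u *: y|) / 2 - 1]].

Definition uniformly_smooth (R : realType) (X : normedModType R) : Prop :=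
  modulus_of_smoothness X u / u @[u --> 0^'] --> (0 : R).

(* [AWBGA D t delta eta eps f phi G]: the elements [phi 1, phi 2, ...] and the
   approximants [G 0, G 1, ...] are a realization, for the target [f], of an
   algorithm of the class. The values [phi 0], [t 0], [eta 0] and [eps 0] are
   never used. *)
Definition AWBGA (R : realType) (X : normedModType R) (D : set X)
    (t delta eta eps : nat -> R) (f : X) (phi G : nat -> X) : Prop :=
  let rem m := f - G m in
  [/\ forall m, (0 < m)%N -> D (phi m),
      G 0 = 0,
      forall m, (0 < m)%N ->
        linear_span (phi @` [set k | (1 <= k <= m)%N]) (G m) &
      exists F : nat -> {linear X -> R^o},
        [/\ forall m, continuous (F m),
            forall m, rem m != 0 ->
              dual_norm (F m) <= 1 /\ (1 - delta m) * `|rem m| <= F m (rem m),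
            forall m, (0 < m)%N -> rem m.-1 != 0 ->
              t m * dict_norm D (F m.-1) <= F m.-1 (phi m),
            forall m, (0 < m)%N ->
              `|rem m| <= (1 + eta m) *
                inf [set `|rem m.-1 - l *: phi m| | l in [set l : R | 0 <= l]] &
            forall m, (0 < m)%N -> rem m != 0 -> `|F m (G m)| <= eps m]].

(* Main.v *)
(* For a norm-one [F] almost norming [x], uniform smoothness gives
   [|x - l g| <= |x| (1 + d + 2 gamma (l / |x|)^q) - l F(g)].  Take [x = f_{m-1}]
   and [g = phi_m], and suppose [|x| >= alpha].  Since [f] is close to some [h] in
   the span of [D] and [F_{m-1}(G_{m-1})] is small, [F_{m-1}(h)] is at least
   [alpha / 2], so the dictionary norm of [F_{m-1}] is bounded below by a constant
   depending on [alpha] only.  Optimizing over [l], a step decreases the norm by at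
   least [c t_m^p], the errors [delta_{m-1}] and [eta_m] being negligible against
   [t_m^p].  The divergence of the series then forces the norm below [alpha] at some
   late step; from there it never exceeds [2 alpha], because a step from below
   [alpha] at most doubles the norm and a step from above decreases it. *)
Require Import Defs.
From HB Require Import structures.
From mathcomp Require Import all_boot all_order all_algebra.
From mathcomp Require Import all_classical all_reals all_analysis.
Import Order.TTheory GRing.Theory Num.Theory.
Import numFieldNormedType.Exports.
Local Open Scope classical_set_scope.
Local Open Scope ring_scope.

From mathcomp Require Import lra ring.

Set Implicit Arguments.
Unset Strict Implicit.

(** After normalizing [x] and [y], this is the modulus at [l * |y| / |x|], which is at most
    [l / |x|]; a zero [y] has no direction and is treated apart. *)
Lemma smoothness_parallelogram (R : realType) (X : normedModType R)
    (gamma q : R) (x y : X) (l : R) :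
  0 <= gamma -> 0 <= q ->
  (forall u : R, 0 <= u -> modulus_of_smoothness X u <= gamma * u `^ q) ->
  x != 0 -> `|y| <= 1 -> 0 <= l ->
  `|x + l *: y| + `|x - l *: y| <= 2 * `|x| * (1 + gamma * (l / `|x|) `^ q).
Proof.
move=> gamma_ge0 q_ge0 Xrho x_neq0 y_le1 l_ge0.
have x_gt0 : 0 < `|x| by rewrite normr_gt0.
have lx_ge0 : 0 <= l / `|x| by rewrite divr_ge0 // ltW.
have [->|y_neq0] := eqVneq y 0.
  rewrite !scaler0 addr0 subr0.
  suff : 0 <= `|x| * (gamma * (l / `|x|) `^ q) by lra.
  by rewrite !mulr_ge0 ?powR_ge0 // ltW.
have y_gt0 : 0 < `|y| by rewrite normr_gt0.
set u := l * `|y| / `|x|.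
have u_ge0 : 0 <= u by rewrite /u divr_ge0 ?mulr_ge0 // ltW.
set x' := `|x|^-1 *: x; set y' := `|y|^-1 *: y.
have x'1 : `|x'| = 1 by rewrite normrZ normfV normr_id mulVf ?gt_eqF.
have y'1 : `|y'| = 1 by rewrite normrZ normfV normr_id mulVf ?gt_eqF.
have u_le : gamma * u `^ q <= gamma * (l / `|x|) `^ q.
  rewrite ler_wpM2l // ge0_ler_powR ?nnegrE // /u.
  rewrite ler_wpM2r ?invr_ge0 ?ler_piMr //; exact: ltW.
have unit_le : (`|x' + u *: y'| + `|x' - u *: y'|) / 2 - 1 <= gamma * u `^ q.
  apply: le_trans (Xrho u u_ge0).
  apply: ub_le_sup; last by exists x', y'.
  (* The set is bounded above by [u], so its [sup] is a genuine upper bound. *)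
  exists u => r [a [b [a1 b1 ->]]].
  have := ler_normD a (u *: b); have := ler_normB a (u *: b).
  by rewrite normrZ a1 b1 (ger0_norm u_ge0) mulr1; lra.
have scale_x : x = `|x| *: x' by rewrite scalerA divff ?gt_eqF // scale1r.
have scale_y : l *: y = `|x| *: (u *: y').
  rewrite !scalerA; congr (_ *: _); rewrite /u; field.
  by rewrite !gt_eqF.
rewrite scale_y [X in `|X + _|]scale_x [X in `|X - _|]scale_x.
rewrite -scalerDr -scalerBr !normrZ normr_id -mulrDr -mulrA mulrCA.
by rewrite ler_pM2l //; lra.
Qed.

(** Continuity bounds the set defining [dual_norm], so that its [sup] is not a default value; the
    rest is homogeneity. *)
Lemma dual_norm_le (R : realType) (X : normedModType R)
    (F : {linear X -> R^o}) (x : X) :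
  continuous F -> dual_norm F <= 1 -> `|F x| <= `|x|.
Proof.
move=> /linear_bounded_continuous /linear_boundedP [M [_ FM]] F_le1.
have [->|x_neq0] := eqVneq x 0; first by rewrite linear0 !normr0.
have x_gt0 : 0 < `|x| by rewrite normr_gt0.
suff : `|F (`|x|^-1 *: x)| <= 1.
  by rewrite linearZ normrZ normfV normr_id mulrC ler_pdivrMr ?mul1r.
apply: le_trans F_le1; apply: ub_le_sup; last first.
  by exists (`|x|^-1 *: x) => //=; rewrite normrZ normfV normr_id mulVf ?gt_eqF.
exists (`|M| + 1) => _ [z /= z_le1 <-].
apply: le_trans (FM (`|M| + 1) _ z) _.
  by have := ler_norm M; lra.
by rewrite ler_piMr //; have := normr_ge0 M; lra.
Qed.

(** Since [F] has norm at most one, [|x + l g|] is at least [(1 - d) |x| + l F(g)]; subtract this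
    from the parallelogram bound. *)
Lemma norm_step_le (R : realType) (X : normedModType R) (gamma q d l : R)
    (x g : X) (F : {linear X -> R^o}) :
  0 <= gamma -> 0 <= q ->
  (forall u : R, 0 <= u -> modulus_of_smoothness X u <= gamma * u `^ q) ->
  continuous F -> dual_norm F <= 1 -> (1 - d) * `|x| <= F x ->
  x != 0 -> `|g| <= 1 -> 0 <= l ->
  `|x - l *: g| <= `|x| * (1 + d + 2 * gamma * (l / `|x|) `^ q) - l * F g.
Proof.
move=> gamma_ge0 q_ge0 Xrho Fcont F_le1 Fx x_neq0 g_le1 l_ge0.
have := smoothness_parallelogram gamma_ge0 q_ge0 Xrho x_neq0 g_le1 l_ge0.
have := dual_norm_le (x + l *: g) Fcont F_le1.
have := ler_norm (F (x + l *: g)).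
by rewrite linearD linearZ /= /GRing.scale /=; nra.
Qed.

(** Symmetry of [D] bounds each [|F(g_i)|] by the dictionary norm. The constant is uniform in [F],
    as is needed when [F] varies with the step. *)
Lemma linear_span_dict_norm (R : realType) (X : normedModType R) (D : set X)
    (x : X) :
  dictionary D -> linear_span D x ->
  exists2 A : R, 0 < A & forall F : {linear X -> R^o}, continuous F ->
    dual_norm F <= 1 -> F x <= A * dict_norm D F.
Proof.
move=> [D_le1 _ D_opp] [n [a [g [Dg ->]]]].
have sum_ge0 : 0 <= \sum_(i < n) `|a i| by rewrite sumr_ge0.
exists (\sum_(i < n) `|a i| + 1) => [|F Fcont F_le1]; first by lra.
have le_dict h : D h -> F h <= dict_norm D F.
  move=> Dh; apply: ub_le_sup; last by exists h.
  exists 1 => _ [z Dz <-]; apply: le_trans (D_le1 _ Dz).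
  exact: le_trans (ler_norm _) (dual_norm_le _ Fcont F_le1).
have abs_le_dict h : D h -> `|F h| <= dict_norm D F.
  move=> Dh; rewrite ler_norml le_dict // andbT lerNl.
  by rewrite -(linearN F); exact/le_dict/D_opp.
have dict_ge0 : 0 <= dict_norm D F.
  have [->|/set0P[h Dh]] := eqVneq D set0; last exact: le_trans (abs_le_dict _ Dh).
  by rewrite /dict_norm image_set0 sup0.
rewrite linear_sum mulrDl mul1r mulr_suml.
apply: (@le_trans _ _ (\sum_(i < n) `|a i| * dict_norm D F)); last by lra.
apply: ler_sum => i _; rewrite linearZ /=.
apply: le_trans (ler_norm _) _; rewrite normrM.
by apply: ler_wpM2l => //; exact: abs_le_dict.
Qed.

(* The step [s] is a multiple of [t `^ (p - 1)], where [p - 1 = 1 / (q - 1)],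
   so that [s `^ q] and [s * t] are both multiples of [t `^ p]. *)
Lemma power_step (R : realType) (c q b : R) :
  0 < c -> 1 < q -> 0 < b ->
  exists2 kappa : R, 0 < kappa & forall t, 0 <= t ->
    exists2 s, 0 <= s & c * s `^ q - s * (t * b) = - kappa * t `^ (q / (q - 1)).
Proof.
move=> c_gt0 q_gt1 b_gt0.
have q1_neq0 : q - 1 != 0 by rewrite gt_eqF // subr_gt0.
(* This [a] solves [c a^q = a b / 2]: the power term cancels half of the linear gain. *)
set a := (b / (2 * c)) `^ (q - 1)^-1.
have a_gt0 : 0 < a by rewrite powR_gt0 // divr_gt0 // mulr_gt0.
have aq : a `^ q = b / (2 * c) * a.
  rewrite -[in LHS](subrK 1 q) powRD; last by rewrite (gt_eqF a_gt0) implybT.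
  rewrite powRr1 ?(ltW a_gt0) // -powRrM mulVf // powRr1 //.
  by rewrite divr_ge0 ?mulr_ge0 // ltW.
exists (a * b / 2) => [|t t_ge0]; first by rewrite divr_gt0 ?mulr_gt0.
exists (a * t `^ (q - 1)^-1); first by rewrite mulr_ge0 ?powR_ge0 ?(ltW a_gt0).
have tp : t * t `^ (q - 1)^-1 = t `^ (q / (q - 1)).
  rewrite -{1}(powRr1 t_ge0) -powRD; first by congr (_ `^ _); field.
  have -> : 1 + (q - 1)^-1 = q / (q - 1) by field.
  by rewrite mulf_eq0 invr_eq0 (negPf q1_neq0) orbF (gt_eqF (lt_trans ltr01 _)).
rewrite powRM ?powR_ge0 ?(ltW a_gt0) // -powRrM (mulrC _ q) aq -tp; field.
by rewrite gt_eqF.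
Qed.

(** Either [r] drops below [alpha] after [N] and stays trapped under [2 * alpha], or telescoping
    bounds the partial sums of [s], against divergence. *)
Lemma series_descent (R : realType) (r s : nat -> R) (alpha c : R) (N : nat) :
  0 < c -> (forall m, 0 <= r m) -> (forall m, (0 < m)%N -> 0 <= s m) ->
  (\sum_(1 <= k <oo) (s k)%:E = +oo)%E ->
  (forall m, (N <= m)%N -> r m < alpha -> r m.+1 <= 2 * alpha) ->
  (forall m, (N <= m)%N -> alpha <= r m -> r m.+1 <= r m - c * s m.+1) ->
  \forall m \near \oo, r m <= 2 * alpha.
Proof.
move=> c_gt0 r_ge0 s_ge0 s_div r_small r_large.
have [[n Nn rn]|no_small] := pselect (exists2 n, (N <= n)%N & r n < alpha).
  exists n => // m /= /subnKC <-; elim: (m - n)%N => [|k IHk].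
    (* Positivity of [alpha] comes from [0 <= r n < alpha]. *)
    by rewrite addn0; have := r_ge0 n; lra.
  rewrite addnS; have Nnk : (N <= n + k)%N by rewrite (leq_trans Nn) ?leq_addr.
  have [/r_small -> //|/(r_large _ Nnk)] := ltP (r (n + k)%N) alpha.
  have := s_ge0 (n + k).+1 isT; nra.
have large m : (N <= m)%N -> alpha <= r m.
  by move=> Nm; rewrite leNgt; apply/negP => rm; apply: no_small; exists m.
pose S m := \sum_(1 <= k < m.+1) s k.
have telescope m : (N <= m)%N -> c * S m + r m <= c * S N + r N.
  move=> /subnKC <-; elim: (m - N)%N => [|k]; first by rewrite addn0.
  rewrite addnS /S [in X in _ -> X]big_nat_recr //=.
  have Nk : (N <= N + k)%N by rewrite leq_addr.
  by have := r_large _ Nk (large _ Nk); lra.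
suff : (+oo <= (S N + r N / c)%:E :> \bar R)%E by [].
rewrite -s_div; apply: lime_le.
  by apply: is_cvg_nneseries => n n_gt0 _; rewrite lee_fin s_ge0.
exists N.+1 => // -[//|m] /= Nm; rewrite sumEFin lee_fin -/(S m).
have := telescope m Nm; have := r_ge0 m.
rewrite -(ler_pM2l c_gt0 (S m)) mulrDr (mulrCA c) divff ?gt_eqF //; lra.
Qed.

Unset Implicit Arguments.
Set Strict Implicit.

Theorem theorem8p1 (R : realType) (X : completeNormedModType R)
    (gamma q p : R) (D : set X) (t delta eta eps : nat -> R)
    (Xsmooth : uniformly_smooth X)
    (gamma_gt0 : 0 < gamma) (q_bounds : 1 < q <= 2)
    (Xrho : forall u : R, 0 <= u ->
       modulus_of_smoothness X u <= gamma * u `^ q)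
    (p_def : p = q / (q - 1))
    (Ddict : dictionary D)
    (t01 : forall m, (0 < m)%N -> 0 <= t m <= 1)
    (delta01 : forall m, 0 <= delta m <= 1)
    (eta01 : forall m, (0 < m)%N -> 0 <= eta m <= 1)
    (eps_ge0 : forall m, (0 < m)%N -> 0 <= eps m)
    (t_div : (\sum_(1 <= k <oo) (t k `^ p)%:E = +oo)%E)
    (delta_eta_o : (fun m => delta m.-1 + eta m : R^o)
                     =o_\oo (fun m => t m `^ p : R^o))
    (eps_o : (eps : nat -> R^o) =o_\oo (fun=> 1 : R^o)) :
  forall (f : X) (phi G : nat -> X),
    AWBGA D t delta eta eps f phi G ->
    `|f - G m| @[m --> \oo] --> (0 : R).
Proof.
move=> f phi G [Dphi _ _ [F [Fcont Fnorming Fgreedy Gstep FG]]].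
have [D_le1 D_dense _] := Ddict.
have [q_gt1 _] := andP q_bounds.
have q_ge0 : 0 <= q by lra.
set r := fun m => `|f - G m|.
have r_ge0 m : 0 <= r m by exact: normr_ge0.
have tp_ge0 m : (0 < m)%N -> 0 <= t m `^ p by rewrite powR_ge0.
have tp_le1 m : (0 < m)%N -> t m `^ p <= 1.
  move=> /t01/andP[t_ge0 t_le1]; have -> : 1 = 1 `^ p by rewrite powR1.
  by rewrite ge0_ler_powR ?nnegrE // p_def divr_ge0 //; lra.
suff eventually_le (alpha : R) : 0 < alpha -> \forall m \near \oo, r m <= 2 * alpha.
  apply/cvgrPdist_le => e e_gt0; have := eventually_le (e / 2).
  rewrite divr_gt0 // => /(_ isT); apply: filterS => m.
  by rewrite sub0r normrN normr_id mulrC divfK.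
move=> alpha_gt0.
(* With [delta m <= 1/4] and two errors of [alpha / 8], [F m h] keeps at least
   [3/4 - 1/8 - 1/8 = 1/2] of [alpha]. *)
have alpha8_gt0 : 0 < alpha / 8 by rewrite divr_gt0.
have [h [Dh fh]] : exists h, linear_span D h /\ `|f - h| < alpha / 8.
  have : closure (linear_span D) f by rewrite D_dense.
  move=> /(_ _ (nbhsx_ballx f _ alpha8_gt0))[h [Dh]].
  by rewrite -ball_normE; exists h.
have [A A_gt0 h_le] := linear_span_dict_norm Ddict Dh.
have b_gt0 : 0 < alpha / (2 * A) by rewrite divr_gt0 ?mulr_gt0.
have gamma2_gt0 : 0 < 2 * gamma by rewrite mulr_gt0.
have [kappa kappa_gt0 step_ex] := power_step gamma2_gt0 q_gt1 b_gt0.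
have c_gt0 : 0 < alpha * (kappa / 2) by rewrite mulr_gt0 ?divr_gt0.
(* The first bound gives [delta m <= 1/4], as [t^p <= 1]; the second lets the errors consume at most
   half of the gain [kappa t^p]. *)
pose mu := Num.min 4^-1 (kappa / 4).
have mu_gt0 : 0 < mu by rewrite lt_min invr_gt0 divr_gt0 ?ltr0n.
have mu_le4 : mu <= 4^-1 by rewrite ge_min lexx.
have mu_le_kappa : mu <= kappa / 4 by rewrite ge_min lexx orbT.
have /eqoP/(_ _ mu_gt0)[N1 _ delta_eta_le] := delta_eta_o.
have /eqoP/(_ _ alpha8_gt0)[N2 _ eps_le] := eps_o.
have r_step m l : 0 <= l ->
    r m.+1 <= (1 + eta m.+1) * `|f - G m - l *: phi m.+1|.
  move=> l_ge0; apply: le_trans (Gstep m.+1 isT) _.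
  rewrite ler_wpM2l ?addr_ge0 ?(andP (eta01 m.+1 isT)).1 //.
  by apply: ge_inf; [exists 0 => _ [z _ <-] | exists l].
(* The successor forces [0 < m], from where [F m (G m)] is controlled. *)
apply: (@series_descent _ r (fun m => t m `^ p) alpha _ (maxn N1 N2).+1 c_gt0)
  => // [m _ rm_lt | m].
  (* The choice [l = 0] shows that a step at most doubles the norm. *)
  have := r_step m 0 (lexx 0); rewrite scale0r subr0 -/(r m).
  by have := r_ge0 m; have /andP[] := eta01 m.+1 isT; nra.
rewrite gtn_max => /andP[N1m N2m] rm_ge.
have m_gt0 : (0 < m)%N by case: (m) N1m.
have rm_gt0 : 0 < r m by exact: lt_le_trans rm_ge.
have fm_neq0 : f - G m != 0 by rewrite -normr_gt0.
have /andP[eta_ge0 eta_le1] := eta01 m.+1 isT.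
have /andP[delta_ge0 delta_le1] := delta01 m.
have /andP[t_ge0 t_le1] := t01 m.+1 isT.
have := delta_eta_le m.+1 (leqW (ltnW N1m)).
rewrite /= (ger0_norm (addr_ge0 delta_ge0 eta_ge0)) ger0_norm ?tp_ge0 // => de_le.
have tp0 := tp_ge0 m.+1 isT; have tp1 := tp_le1 m.+1 isT.
have delta_le : delta m <= 4^-1 by nra.
have delta_eta_le' : delta m + eta m.+1 <= kappa / 4 * t m.+1 `^ p by nra.
have epsm_le : eps m <= alpha / 8.
  have := eps_le m (ltnW N2m); rewrite /= normr1 mulr1.
  exact: le_trans (ler_norm _).
have [F_le1 Fm] := Fnorming m fm_neq0.
have FGm := FG m m_gt0 fm_neq0.
(* [F m] sees a fixed proportion of [f - G m] inside the span of [D]. *)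
have dict_ge : alpha / (2 * A) <= dict_norm D (F m).
  rewrite ler_pdivrMr ?mulr_gt0 //.
  have Fh := h_le (F m) (Fcont m) F_le1.
  have Ffh := le_trans (ler_norm _) (dual_norm_le (f - h) (Fcont m) F_le1).
  have FGm' := ler_norm (- F m (G m)).
  rewrite normrN in FGm'.
  have dec : F m (f - G m) = F m (f - h) + F m h - F m (G m).
    by rewrite !linearB subrK.
  rewrite dec -/(r m) in Fm; nra.
have Fphi := Fgreedy m.+1 isT fm_neq0; rewrite /= in Fphi.
have [s s_ge0 s_val] := step_ex (t m.+1) t_ge0.
rewrite -p_def in s_val.
(* The step length is scaled by [r m] so that [l / |f - G m|] is exactly [s]. *)
have l_ge0 : 0 <= r m * s by rewrite mulr_ge0.
apply: le_trans (r_step m (r m * s) l_ge0) _.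
have := norm_step_le (ltW gamma_gt0) q_ge0 Xrho (Fcont m) F_le1 Fm fm_neq0
  (D_le1 _ (Dphi m.+1 isT)) l_ge0.
rewrite -/(r m) [r m * s / r m]mulrAC divff ?gt_eqF // mul1r => step_le.
have gain : r m * s * (t m.+1 * (alpha / (2 * A))) <= r m * s * F m (phi m.+1).
  apply: ler_wpM2l => //; apply: le_trans Fphi; exact: ler_wpM2l.
set tp := t m.+1 `^ p in tp0 tp1 delta_eta_le' s_val *.
have {step_le gain s_val} : `|f - G m - (r m * s) *: phi m.+1| <=
    r m * (1 + delta m - kappa * tp).
  have -> : r m * (1 + delta m - kappa * tp) =
      r m * (1 + delta m + 2 * gamma * s `^ q) -
      r m * s * (t m.+1 * (alpha / (2 * A))).
    have -> : - (kappa * tp) = - kappa * tp by rewrite mulNr.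
    by rewrite -s_val; ring.
  lra.
move=> /(ler_wpM2l (addr_ge0 ler01 eta_ge0)) step_le; apply: le_trans step_le _.
(* The product contributes errors of at most [2 delta + eta], hence at most [kappa / 2 * tp]. *)
have factor_le :
    (1 + eta m.+1) * (1 + delta m - kappa * tp) <= 1 - kappa / 2 * tp.
  have kt_ge0 : 0 <= kappa * tp by rewrite mulr_ge0 // ltW.
  have := mulr_ge0 eta_ge0 kt_ge0.
  have : eta m.+1 * delta m <= delta m by rewrite ler_piMl.
  lra.
have /(ler_wpM2l (ltW rm_gt0)) := factor_le.
rewrite mulrCA => /le_trans; apply.
(* The bound [alpha <= r m] turns the relative decrease into an absolute one. *)
have kt_ge0 : 0 <= kappa / 2 * tp by rewrite mulr_ge0 // divr_ge0 // ltW.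
have := ler_wpM2r kt_ge0 rm_ge; lra.
Qed.
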